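(* Let $n\ge 3$ and $d=\lfloor n/2\rfloor$. For every real symmetric $n\times n$ matrix $D$ with $D_{ij}=D_{ji}>0$ for $i\neq j$, the optimal value of the semidefinite program (A) below is greater than or equal to the optimal value of the semidefinite program (B) below; that is, relaxation (A) dominates relaxation (B). (A) Minimize $\tfrac12\operatorname{trace}\left(DX^{(1)}\right)$ over real symmetric $n\times n$ matrices $X^{(1)},\ldots,X^{(d)}$ subject to $$X^{(k)}\ge 0\ \ (k=1,\ldots,d),\qquad \sum_{k=1}^d X^{(k)}=J-I,\qquad I+\sum_{k=1}^d\cos\left(\frac{2\pi i k}{n}\right)X^{(k)}\succeq 0\ \ (i=1,\ldots,d).$$ (B) Minimize $\tfrac12\operatorname{trace}(DX)$ over real symmetric $n\times n$ matrices $X$ subject to $$Xe=2e,\qquad \operatorname{diag}(X)=0,\qquad 0\le X\le J,\qquad 2I-X+\left(2-2\cos\left(\frac{2\pi}{n}\right)\right)(J-I)\succeq 0.$$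
   Context: $I$ and $J$ denote the $n\times n$ identity and all-ones matrices, and $e\in\mathbb{R}^n$ is the all-ones vector. Inequalities $\ge,\le$ between matrices are entrywise, and $M\succeq 0$ means that $M$ is symmetric positive semidefinite. $\operatorname{diag}(X)$ is the vector of diagonal entries of $X$. Both programs are relaxations (giving lower bounds) of the symmetric traveling salesman problem on $n$ cities with edge length matrix $D$. One such relaxation dominates another if, for every $D$, its lower bound is at least as large as that of the other. *)

(* Defs.v *)
From mathcomp Require Import all_boot all_order all_algebra.
From mathcomp Require Import sesquilinear.
From mathcomp Require Import all_classical all_reals all_analysis.

Set Implicit Arguments.
Unset Strict Implicit.
Unset Printing Implicit Defensive.

Import Order.TTheory GRing.Theory Num.Theory.
Local Open Scope classical_set_scope.
Local Open Scope ring_scope.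

(* Entrywise order, not the Loewner order. *)
Definition mxle (R : realType) (m n : nat) (A B : 'M[R]_(m, n)) : Prop :=
  forall i j, A i j <= B i j.

Definition psdmx (R : realType) (n : nat) (M : 'M[R]_n) : Prop :=
  M \is symmetricmx /\ forall x : 'cV[R]_n, 0 <= (x^T *m M *m x) 0 0.

Definition allones (R : realType) (m n : nat) : 'M[R]_(m, n) := const_mx 1.

Definition diagv (R : realType) (n : nat) (X : 'M[R]_n) : 'cV[R]_n :=
  \col_i X i i.

(* A d-tuple X^(1), ..., X^(d), with d = n./2, is encoded as a family indexed by
   nat of which only the values at 1, ..., d are used (for 2 <= n). *)
Definition sdpA_feasible (R : realType) (n : nat) (X : nat -> 'M[R]_n) : Prop :=
  [/\ forall k, (1 <= k <= n./2)%N -> X k \is symmetricmx,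
      forall k, (1 <= k <= n./2)%N -> mxle 0 (X k),
      \sum_(1 <= k < n./2.+1) X k = allones R n n - 1%:M
    & forall i, (1 <= i <= n./2)%N ->
        psdmx (1%:M + \sum_(1 <= k < n./2.+1)
                        cos (2 * pi * i%:R * k%:R / n%:R) *: X k)].

Definition sdpB_feasible (R : realType) (n : nat) (X : 'M[R]_n) : Prop :=
  [/\ X \is symmetricmx,
      X *m allones R n 1 = 2 *: allones R n 1,
      diagv X = 0,
      mxle 0 X /\ mxle X (allones R n n)
    & psdmx (2%:M - X
             + (2 - 2 * cos (2 * pi / n%:R)) *: (allones R n n - 1%:M))].

(* Optimal values are infima in the extended reals (+oo if infeasible). *)
Definition sdpA_value (R : realType) (n : nat) (D : 'M[R]_n) : \bar R :=
  ereal_inf [set (2^-1 * \tr (D *m X 1%N))%:E | X in @sdpA_feasible R n].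

Definition sdpB_value (R : realType) (n : nat) (D : 'M[R]_n) : \bar R :=
  ereal_inf [set (2^-1 * \tr (D *m X))%:E | X in @sdpB_feasible R n].

(* Main.v *)
Require Import Defs.
From mathcomp Require Import all_boot all_order all_algebra.
From mathcomp Require Import sesquilinear.
From mathcomp Require Import all_classical all_reals all_analysis.
From mathcomp Require Import ring lra zify.

Set Implicit Arguments.
Unset Strict Implicit.
Unset Printing Implicit Defensive.

Import Order.TTheory GRing.Theory Num.Theory.
Local Open Scope ring_scope.

(** If X^(1), ..., X^(d) is feasible for (A), then X^(1) is feasible for (B) and
    has the same objective value, so the infimum in (B) runs over a larger set.

    Feasibility of X^(1) is a discrete Fourier argument.  Write
    c_m = cos (2 pi m / n) and F_i = I + sum_k c_(ik) X^(k).  The matrices F_i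
    with 1 <= i <= d are the ones constrained in (A); F_(n-i) = F_i because the
    cosine is even and periodic, so F_i is positive semidefinite for all
    0 < i < n, and F_0 = J.  Orthogonality of the characters of Z/n inverts the
    transform: [sum_cospencil1] and [sum_cospencil_cos] give

      sum_(i < n) F_i = n I,      sum_(i < n) 2 c_i F_i = n X^(1).

    Row sums.  Let e be the all-ones vector.  In the first identity
    e^T (n I) e = n^2 = e^T F_0 e, hence the nonnegative numbers e^T F_i e,
    0 < i < n, sum to 0, which forces F_i e = 0 for each of them
    ([cospencil_kernel]).  The second identity applied to e then leaves
    n X^(1) e = 2 J e = 2 n e ([row_sums]).

    Semidefinite constraint.  Combining both identities with F_0 = J gives
    ([sdpB_pencilE])

      n (2 I - X^(1) + (2 - 2 c_1) (J - I))
        = (2 - 2 c_1) (n - 1) J + sum_(0 < i < n) 2 (c_1 - c_i) F_i,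

    and c_i <= c_1 for 0 < i < n ([cosn_le]), so the right-hand side is a
    nonnegative combination of positive semidefinite matrices. *)

(** * Positive semidefinite matrices *)

Lemma symmetricmxP (R : realType) (n : nat) (M : 'M[R]_n) :
  reflect (M^T = M) (M \is symmetricmx).
Proof.
by apply: (iffP (sesquiP _ _ _)); rewrite expr0 scale1r map_mx_id // => {2}->.
Qed.

Lemma psdmxD (R : realType) (n : nat) (A B : 'M[R]_n) :
  psdmx A -> psdmx B -> psdmx (A + B).
Proof.
move=> [/symmetricmxP sA pA] [/symmetricmxP sB pB]; split.
  by apply/symmetricmxP; rewrite linearD /= sA sB.
by move=> x; rewrite mulmxDr mulmxDl mxE addr_ge0.
Qed.

Lemma psdmxZ (R : realType) (n : nat) (a : R) (A : 'M[R]_n) :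
  0 <= a -> psdmx A -> psdmx (a *: A).
Proof.
move=> a0 [/symmetricmxP sA pA]; split.
  by apply/symmetricmxP; rewrite linearZ /= sA.
by move=> x; rewrite -scalemxAr -scalemxAl mxE mulr_ge0.
Qed.

Lemma psdmx_gram (R : realType) (m n : nat) (B : 'M[R]_(m, n)) :
  psdmx (B^T *m B).
Proof.
split; first by apply/symmetricmxP; rewrite trmx_mul trmxK.
move=> x; rewrite -mulmxA -mulmxA mulmxA -trmx_mul mxE sumr_ge0 // => i _.
by rewrite mxE -expr2 sqr_ge0.
Qed.

Lemma psdmx0 (R : realType) (n : nat) : psdmx (0 : 'M[R]_n).
Proof. by have := @psdmx_gram R 0 n 0; rewrite mulmx0. Qed.

Lemma allonesE (R : realType) (n : nat) :
  allones R n n = (allones R 1 n)^T *m allones R 1 n.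
Proof.
by apply/matrixP => i j; rewrite !mxE big_ord1 !mxE mulr1.
Qed.

(** With y = M x and x^T M x = 0, the form of M at x + t y is
    2 t |y|^2 + t^2 y^T M y.  If y were nonzero, this would be negative for small
    t < 0. *)
Lemma psdmx_kernel (R : realType) (n : nat) (M : 'M[R]_n) (x : 'cV[R]_n) :
  psdmx M -> (x^T *m M *m x) 0 0 = 0 -> M *m x = 0.
Proof.
move=> [/symmetricmxP sM pM] x0.
pose y := M *m x.
pose b : R := (y^T *m y) 0 0; pose c : R := (y^T *m M *m y) 0 0.
have c0 : 0 <= c by exact: pM.
have expand t : ((x + t *: y)^T *m M *m (x + t *: y)) 0 0
    = 2 * t * b + t ^+ 2 * c.
  have xMy : x^T *m M *m y = y^T *m y by rewrite /y trmx_mul sM.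
  have yMx : y^T *m M *m x = y^T *m y by rewrite -mulmxA.
  have -> : (x + t *: y)^T = x^T + t *: y^T by rewrite linearD linearZ.
  rewrite !mulmxDl !mulmxDr -!scalemxAl -!scalemxAr.
  rewrite xMy yMx /b /c; move: x0.
  move: (x^T *m M *m x) (y^T *m y) (y^T *m M *m y) => p q r p0.
  by rewrite !mxE p0; ring.
have b0 : b = 0.
  have c1 : 0 < c + 1 by lra.
  (* The minimiser of the quadratic in t is - b / c; adding 1 to the denominator
     keeps it nonzero and the value below 0 unless b = 0. *)
  have := pM (x + (- b / (c + 1)) *: y).
  rewrite expand.
  have -> : 2 * (- b / (c + 1)) * b + (- b / (c + 1)) ^+ 2 * c
     = - (b ^+ 2 * (c + 2) / (c + 1) ^+ 2) by field; rewrite lt0r_neq0.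
  have c2 : 0 < c + 2 by lra.
  rewrite oppr_ge0 pmulr_lle0 ?invr_gt0 ?exprn_gt0 // pmulr_lle0 //.
  by move=> h; apply/eqP; rewrite -sqrf_eq0 eq_le h sqr_ge0.
have: \sum_i y i 0 ^+ 2 = 0.
  move: b0; rewrite /b [LHS]mxE => b0; rewrite -[RHS]b0.
  by apply: eq_bigr => i _; rewrite [y^T _ _]mxE expr2.
move/eqP; rewrite psumr_eq0; last by move=> i _; rewrite sqr_ge0.
move=> /allP h.
apply/matrixP => i j; rewrite (ord1 j) [RHS]mxE.
by apply/eqP; rewrite -sqrf_eq0; apply: h; rewrite mem_index_enum.
Qed.

(** * Cosines of multiples of the angle 2 pi / n *)

Definition cosn (R : realType) (n m : nat) : R := cos (2 * pi * m%:R / n%:R).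

Lemma cosn0 (R : realType) (n : nat) : cosn R n 0 = 1.
Proof. by rewrite /cosn mulr0 mul0r cos0. Qed.

Lemma cosnM (R : realType) (n i k : nat) :
  cosn R n (i * k) = cos (2 * pi * i%:R * k%:R / n%:R).
Proof. by rewrite /cosn natrM !mulrA. Qed.

Lemma cosn_refl (R : realType) (n a b k : nat) :
  (0 < n)%N -> (a + b = n * k)%N -> cosn R n a = cosn R n b.
Proof.
move=> n0 abk; rewrite /cosn -[RHS]cosN -[RHS](periodicn (@cosD2pi R) k).
congr cos.
have nz : n%:R != 0 :> R by rewrite pnatr_eq0 -lt0n.
have -> : a%:R = n%:R * k%:R - b%:R :> R by rewrite -natrM -abk natrD addrK.
by rewrite -mulrnA -[pi *+ _]mulr_natr natrM; field.
Qed.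

(** Orthogonality of the k-th character of Z/n to the trivial one.  With
    h = pi k / n, the terms multiplied by 2 sin h telescope, as
    2 sin h cos (2 h i) = sin (2 h (i + 1) - h) - sin (2 h i - h), and the two end
    values agree because 2 h n is a multiple of 2 pi; and 0 < h < pi makes sin h
    nonzero. *)
Lemma sum_cosn_eq0 (R : realType) (n k : nat) :
  (0 < k < n)%N -> \sum_(0 <= i < n) cosn R n (i * k) = 0.
Proof.
move=> /andP[k0 kn].
have n0 : 0 < n%:R :> R by rewrite ltr0n; lia.
have nz : n%:R != 0 :> R by rewrite lt0r_neq0.
pose h : R := pi * k%:R / n%:R.
have h0 : 0 < sin h.
  have kR : 0 < k%:R :> R by rewrite ltr0n.
  apply: sin_gt0_pi; rewrite divr_gt0 ?mulr_gt0 ?pi_gt0 //=.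
  by rewrite ltr_pdivrMr // ltr_pM2l ?pi_gt0 // ltr_nat.
have s0 : 2 * sin h != 0 by rewrite lt0r_neq0 // mulr_gt0.
apply: (mulfI s0); rewrite mulr0.
pose f (i : nat) : R := sin (2 * h * i%:R - h).
rewrite mulr_sumr (eq_bigr (fun i => f i.+1 - f i)); last first.
  move=> i _; rewrite /f.
  have -> : 2 * h * i.+1%:R - h = 2 * h * i%:R + h by rewrite -natr1; ring.
  have -> : cosn R n (i * k) = cos (2 * h * i%:R).
    by rewrite /cosn /h natrM; congr cos; field.
  by rewrite sinD sinB; ring.
rewrite telescope_sumr // /f mulr0 add0r.
have -> : 2 * h * n%:R - h = - h + (pi *+ 2) *+ k.
  by rewrite -mulrnA -[pi *+ _]mulr_natr natrM /h; field.
by rewrite (periodicn (@sinD2pi R)) subrr.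
Qed.

Lemma cosn_prod (R : realType) (n i k : nat) :
  2 * cosn R n i * cosn R n (i * k.+1)
    = cosn R n (i * k.+2) + cosn R n (i * k).
Proof.
rewrite /cosn.
set t := 2 * pi * i%:R / n%:R.
have E m : 2 * pi * (i * m)%:R / n%:R = t * m%:R :> R.
  by rewrite /t natrM; ring.
rewrite !E.
have -> : t * k.+2%:R = t * k.+1%:R + t by rewrite -(natr1 k.+1); ring.
have -> : t * k%:R = t * k.+1%:R - t by rewrite -(natr1 k); ring.
by rewrite cosD cosB; ring.
Qed.

(** The cosine decreases on [0, pi], which covers i <= n / 2; the other indices
    are reflected there by i |-> n - i. *)
Lemma cosn_le (R : realType) (n i : nat) :
  (0 < i < n)%N -> cosn R n i <= cosn R n 1.
Proof.
have low j : (0 < j)%N -> (j.*2 <= n)%N -> cosn R n j <= cosn R n 1.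
  move=> j0 jn.
  have n0 : 0 < n%:R :> R by rewrite ltr0n; lia.
  have itv m : (m.*2 <= n)%N -> 2 * pi * m%:R / n%:R \in `[0, (pi : R)].
    move=> mn; rewrite in_itv /= divr_ge0 ?mulr_ge0 ?pi_ge0 ?ler0n //=.
    rewrite ler_pdivrMr // [2 * _]mulrC -mulrA ler_pM2l ?pi_gt0 //.
    by rewrite -natrM ler_nat mul2n.
  rewrite leNgt ltr_cos ?itv //; last lia.
  rewrite -leNgt ler_pM2r ?invr_gt0 // ler_pM2l ?mulr_gt0 ?pi_gt0 //.
  by rewrite ler_nat.
move=> /andP[i0 ni]; case: (leqP i.*2 n) => [|h]; first exact: low.
rewrite (@cosn_refl R n i (n - i) 1); [|lia|lia].
by apply: low; lia.
Qed.

(** * The Fourier transform of a family of matrices *)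

(** The Fourier transform at i of the family indexed by Z/n that is I at 0 and
    is the even extension of X with X k split evenly between k and - k (for
    k = n / 2, X k itself).  Every index i : nat is allowed, so that sums can run
    over all characters instead of 1 <= i <= n / 2 only. *)
Definition cospencil (R : realType) (n : nat) (X : nat -> 'M[R]_n) (i : nat)
    : 'M[R]_n :=
  1%:M + \sum_(1 <= k < n./2.+1) cosn R n (i * k) *: X k.

Lemma sum_cospencil (R : realType) (n : nat) (X : nat -> 'M[R]_n)
    (a : nat -> R) :
  \sum_(0 <= i < n) a i *: cospencil X i
    = (\sum_(0 <= i < n) a i)%:M
      + \sum_(1 <= k < n./2.+1)
          (\sum_(0 <= i < n) a i * cosn R n (i * k)) *: X k.
Proof.
under [X in _ + X]eq_bigr do rewrite scaler_suml.
rewrite exchange_big /= -scalemx1 scaler_suml -big_split /=.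
apply: eq_bigr => i _; rewrite scalerDr scaler_sumr; congr (_ + _).
by apply: eq_bigr => k _; rewrite scalerA.
Qed.

(** Fourier inversion at 0. *)
Lemma sum_cospencil1 (R : realType) (n : nat) (X : nat -> 'M[R]_n) :
  \sum_(0 <= i < n) cospencil X i = n%:R%:M.
Proof.
transitivity (\sum_(0 <= i < n) (1 : R) *: cospencil X i).
  by apply: eq_bigr => i _; rewrite scale1r.
rewrite sum_cospencil sumr_const_nat subn0 [X in _ + X]big1_seq ?addr0 //.
move=> k /=; rewrite mem_index_iota => kn.
under eq_bigr do rewrite mul1r.
by rewrite sum_cosn_eq0 ?scale0r //; lia.
Qed.

(** Fourier inversion at 1.  By the product formula, the coefficient of X k is the
    sum over i of c_(i (k+1)) + c_(i (k-1)), which vanishes unless k = 1; for this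
    k + 1 must stay below n over the whole range k <= n / 2, hence 3 <= n. *)
Lemma sum_cospencil_cos (R : realType) (n : nat) (X : nat -> 'M[R]_n) :
  (3 <= n)%N ->
  \sum_(0 <= i < n) (2 * cosn R n i) *: cospencil X i = n%:R *: X 1%N.
Proof.
move=> n3.
have n1 : (0 < 1 < n)%N by lia.
rewrite sum_cospencil -mulr_sumr.
have -> : \sum_(0 <= i < n) cosn R n i = 0.
  by rewrite -[RHS](sum_cosn_eq0 R n1); apply: eq_bigr => i _; rewrite muln1.
rewrite mulr0 raddf0 add0r big_ltn ?ltnS; last by lia.
rewrite [X in _ + X]big1_seq ?addr0; last first.
  move=> [|k] /=; rewrite mem_index_iota => kn; first by lia.
  under eq_bigr do rewrite cosn_prod.
  by rewrite big_split /= !sum_cosn_eq0 ?addr0 ?scale0r //; lia.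
congr (_ *: _); under eq_bigr do rewrite cosn_prod.
rewrite big_split /= sum_cosn_eq0; last by lia.
under eq_bigr do rewrite muln0 cosn0.
by rewrite sumr_const_nat subn0 add0r.
Qed.

(** * Feasible points of the first program *)

Section Feasible.
Variables (R : realType) (n : nat) (X : nat -> 'M[R]_n).
Hypotheses (hn : (3 <= n)%N) (feasX : sdpA_feasible X).

Lemma cospencil0 : cospencil X 0 = allones R n n.
Proof.
have [_ _ sumX _] := feasX.
rewrite /cospencil; under eq_bigr do rewrite mul0n cosn0 scale1r.
by rewrite sumX addrC subrK.
Qed.

(** The program constrains only 1 <= i <= n / 2; the reflection i |-> n - i
    supplies the remaining indices. *)
Lemma psdmx_cospencil i : (0 < i < n)%N -> psdmx (cospencil X i).
Proof.
have [_ _ _ psdX] := feasX.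
have low j : (1 <= j <= n./2)%N -> psdmx (cospencil X j).
  by rewrite /cospencil; under eq_bigr do rewrite cosnM; exact: psdX.
move=> ni; case: (leqP i n./2) => h; first by apply: low; lia.
suff -> : cospencil X i = cospencil X (n - i) by apply: low; lia.
congr (_ + _); apply: eq_bigr => k _; congr (_ *: _).
by apply: (@cosn_refl R n _ _ k); [lia|rewrite -mulnDl subnKC //; lia].
Qed.

(** In sum_i F_i = n I, the term F_0 = J alone accounts for the value of the form
    at the all-ones vector e, so the nonnegative values of the other F_i at e
    vanish. *)
Lemma cospencil_kernel i : (0 < i < n)%N -> cospencil X i *m allones R n 1 = 0.
Proof.
move=> ni; set e := allones R n 1.
apply: psdmx_kernel; first exact: psdmx_cospencil.
pose q (M : 'M[R]_n) : R := (e^T *m M *m e) 0 0.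
have q0 j : (1 <= j < n)%N -> 0 <= q (cospencil X j).
  by move=> /psdmx_cospencil [_]; apply.
have qD : q (\sum_(0 <= j < n) cospencil X j) = \sum_(0 <= j < n) q (cospencil X j).
  by rewrite /q mulmx_sumr mulmx_suml summxE.
have n0 : (0 < n)%N by lia.
have eE : e^T *m e = n%:R%:M.
  apply/matrixP => a b; rewrite !mxE !ord1 eqxx mulr1n.
  rewrite (eq_bigr (fun=> 1)) ?sumr_const ?card_ord // => k _.
  by rewrite !mxE mulr1.
have q1 : \sum_(1 <= j < n) q (cospencil X j) = 0.
  move: qD; rewrite sum_cospencil1 big_ltn // cospencil0.
  suff -> : q n%:R%:M = q (allones R n n).
    by move/esym/eqP; rewrite -subr_eq0 addrC addKr => /eqP.
  have -> : allones R n n = e *m e^T.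
    by apply/matrixP => a b; rewrite !mxE big_ord1 !mxE mulr1.
  by rewrite /q mul_mx_scalar -scalemxAl eE mulmxA eE -mulmxA eE mul_scalar_mx.
move: q1; rewrite big_seq => /eqP; rewrite psumr_eq0; last first.
  by move=> j; rewrite mem_index_iota; apply: q0.
by move=> /allP/(_ i); rewrite mem_index_iota ni => /(_ isT)/eqP.
Qed.

(** In n X 1 = sum_i 2 c_i F_i, only F_0 = J acts nontrivially on the all-ones
    vector. *)
Lemma row_sums : X 1%N *m allones R n 1 = 2 *: allones R n 1.
Proof.
have nz : n%:R != 0 :> R by rewrite pnatr_eq0; lia.
apply: (scalerI nz); rewrite scalemxAl -sum_cospencil_cos // mulmx_suml.
rewrite big_ltn; last by lia.
rewrite [X in _ + X]big1_seq ?addr0; last first.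
  move=> i; rewrite mem_index_iota => /andP[_ ni].
  by rewrite -scalemxAl cospencil_kernel // scaler0.
rewrite cospencil0 cosn0 mulr1 -scalemxAl scalerA mulrC -scalerA; congr (_ *: _).
apply/matrixP => a b; rewrite !mxE.
rewrite (eq_bigr (fun=> 1)) ?sumr_const ?card_ord ?mulr1 // => k _.
by rewrite !mxE mulr1.
Qed.

(** This yields both the zero diagonal of X 1 and its upper bound J. *)
Lemma mxle_offdiag : mxle (X 1%N) (allones R n n - 1%:M).
Proof.
have [_ X0 <- _] := feasX => i j.
rewrite big_ltn ?ltnS; last by lia.
rewrite [leRHS]mxE lerDl summxE big_seq sumr_ge0 // => k.
rewrite mem_index_iota => kn.
by have := X0 k; rewrite /mxle => /(_ _ i j); rewrite mxE; apply; lia.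
Qed.

(** The certificate for the semidefinite constraint: its coefficients are the
    Fourier coefficients of the left-hand side, and all of them are
    nonnegative. *)
Lemma sdpB_pencilE (c := cosn R n 1) :
  n%:R *: (2%:M - X 1%N + (2 - 2 * c) *: (allones R n n - 1%:M))
    = ((2 - 2 * c) * (n%:R - 1)) *: allones R n n
      + \sum_(1 <= i < n) (2 * (c - cosn R n i)) *: cospencil X i.
Proof.
(* The two inversion formulas combine over all i < n; the term i = 0 is then
   merged with the multiple of J. *)
transitivity ((2 - 2 * c) * n%:R *: allones R n n
    + \sum_(0 <= i < n) (2 * (c - cosn R n i)) *: cospencil X i).
  under eq_bigr do rewrite mulrBr scalerBl.
  rewrite sumrB -scaler_sumr sum_cospencil1 sum_cospencil_cos //.
  apply/matrixP => i j; rewrite !mxE.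
  by case: (i == j); rewrite ?mulr1n ?mulr0n; ring.
rewrite big_ltn; last by lia.
by rewrite cospencil0 cosn0 addrA -scalerDl; congr (_ *: _ + _); ring.
Qed.

Lemma sdpA_feasible_sdpB : sdpB_feasible (X 1%N).
Proof.
have [symX X0 sumX _] := feasX.
have d1 : (1 <= 1 <= n./2)%N by lia.
have n0 : 0 < n%:R :> R by rewrite ltr0n; lia.
split; [exact: symX|exact: row_sums| | | ].
- apply/matrixP => i j; rewrite !mxE; apply/eqP; rewrite eq_le.
  have := mxle_offdiag i i; have := X0 _ d1 i i.
  by rewrite !mxE eqxx subrr => -> ->.
- split; first exact: X0.
  move=> i j; apply: le_trans (mxle_offdiag i j) _.
  by rewrite !mxE gerBl ler0n.
- have -> : cos (2 * pi / n%:R) = cosn R n 1 by rewrite /cosn mulr1.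
  have c1 : cosn R n 1 <= 1 by exact: cos_le1.
  rewrite -[M in psdmx M](scalerK (lt0r_neq0 n0)) sdpB_pencilE.
  apply: psdmxZ; first by rewrite invr_ge0 ltW.
  apply: psdmxD.
    apply: psdmxZ; last by rewrite allonesE; apply: psdmx_gram.
    have : 1 <= n%:R :> R by rewrite ler1n; lia.
    by move=> ?; rewrite mulr_ge0 //; lra.
  rewrite big_seq; apply: big_ind; [exact: psdmx0|exact: psdmxD|].
  move=> i; rewrite mem_index_iota => ni.
  apply: psdmxZ; last exact: psdmx_cospencil.
  by have := @cosn_le R n i ni; lra.
Qed.

End Feasible.

Theorem theorem4 (R : realType) (n : nat) (hn : (3 <= n)%N) (D : 'M[R]_n)
    (Dsym : D \is symmetricmx)
    (Dpos : forall i j : 'I_n, i != j -> 0 < D i j) :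
  (sdpB_value D <= sdpA_value D)%E.
Proof.
apply: ereal_inf_le_tmp => _ [X feasX <-].
by exists (X 1%N) => //; apply: sdpA_feasible_sdpB.
Qed.
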